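(* Let $f(n)$ be the number of permutations $\pi\in\mathfrak S_n$ all of whose valleys are even and all of whose peaks are odd (with $f(0)=1$), and let $F(x)=\sum_{n\ge0} f(n)\,x^n/n!$. Then \[ F(x)=\frac{3\sin\left(\tfrac{1}{2}x\right)+3\cosh\left(\tfrac{1}{2}\sqrt{3}x\right)}{3\cos\left(\tfrac{1}{2}x\right)-\sqrt{3}\sinh\left(\tfrac{1}{2}\sqrt{3}x\right)}. \]
   Context: $\mathfrak S_n$ is the set of permutations $\pi=\pi_1\pi_2\cdots\pi_n$ of $[n]=\{1,\dots,n\}$. An index $i$ with $2\le i\le n-1$ is a peak of $\pi$ if $\pi_{i-1}<\pi_i>\pi_{i+1}$ and a valley of $\pi$ if $\pi_{i-1}>\pi_i<\pi_{i+1}$. ''All valleys even and all peaks odd'' means every valley index is an even integer and every peak index is an odd integer. *)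

(* Defs.v *)
From mathcomp Require Import all_boot all_fingroup.
Set Implicit Arguments. Unset Strict Implicit. Unset Printing Implicit Defensive.

(* One-line notation of s : 'S_n, with values 0..n-1 (order-isomorphic to 1..n). *)
Definition word (n : nat) (s : 'S_n) : seq nat := [seq val (s i) | i <- enum 'I_n].

(* 1-based position i (2 <= i <= n-1) of the word w: pi_i = nth 0 w (i-1). *)
Definition is_peak (w : seq nat) (i : nat) : bool :=
  [&& 2 <= i, i <= (size w).-1,
      nth 0 w (i - 2) < nth 0 w (i - 1) & nth 0 w i < nth 0 w (i - 1)].
Definition is_valley (w : seq nat) (i : nat) : bool :=
  [&& 2 <= i, i <= (size w).-1,
      nth 0 w (i - 1) < nth 0 w (i - 2) & nth 0 w (i - 1) < nth 0 w i].

Definition valleys_even_peaks_odd (n : nat) (s : 'S_n) : bool :=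
  [forall i : 'I_n.+1,
     (is_valley (word s) i ==> ~~ odd i) && (is_peak (word s) i ==> odd i)].

Definition f_count (n : nat) : nat := #|[set s : 'S_n | valleys_even_peaks_odd s]|.

(* Main.v *)
Require Import Defs.
From Stdlib Require Import Reals Factorial Lra.
From Coquelicot Require Import Coquelicot.
From mathcomp Require Import all_boot all_fingroup zify.
Open Scope R_scope.

(** Cut a permutation of [n + 1] at its maximum. If the maximum sits at an odd
    position, the left part is an arbitrary permutation of the class of even
    length, and the complement of the right part is an arbitrary one as well. If it
    sits at an even position it must come last, and the left part must not end
    with a descent. The permutations satisfying this extra end condition (ending
    with an ascent in odd length, with a descent in even length) obey an
    analogous recurrence. Writing A, B for the even and odd parts of F, and U, H
    for the even and odd parts of the second generating function, this reads
      A' = A B + H,  B' = A^2,  H' = A U,  U' = A H,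
    with initial values 1, 0, 0, 1. With c = cos (x/2), s = sin (x/2),
    C = cosh (sqrt 3 x/2), S = sinh (sqrt 3 x/2) and Q = 3 c^2 - S^2, the solution is
      A = (3 C c + sqrt 3 s S) / Q,  B = (3 s c + sqrt 3 C S) / Q,
      H = 2 sqrt 3 c S / Q,  U = (3 c^2 + S^2) / Q,
    and A + B simplifies to the stated quotient. *)

(** * Uniqueness for the differential system *)

Ltac rewrite_derivatives :=
  repeat match goal with
  | d : is_derive ?f ?x _ |- context [Derive (fun y => ?f y) ?x] =>
      rewrite (is_derive_unique (fun y : R => f y) x _ d)
  end.

(** The mean value theorem is applied to [E x * exp (- k * x)], with [k = K] to the right of 0 and
    [k = - K] to the left; in both cases the increment from 0 is nonpositive. *)
Lemma gronwall_zero (E dE : R -> R) (K r : R) :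
  (forall x, Rabs x < r -> is_derive E x (dE x)) ->
  (forall x, Rabs x < r -> Rabs (dE x) <= K * E x) ->
  (forall x, 0 <= E x) -> E 0 = 0 ->
  forall x, Rabs x < r -> E x = 0.
Proof.
intros HE HK Epos E0 x xr.
assert (mono : forall k, (k = K \/ k = - K) -> exists y, (0 <= y * x /\ Rabs y < r) /\
   E x * exp (- k * x) = (dE y - k * E y) * exp (- k * y) * x).
{ intros k Hk.
  destruct (MVT_gen (fun x => E x * exp (- k * x)) 0 x
    (fun y => (dE y - k * E y) * exp (- k * y))) as [y [Hy Ey]].
  - intros y Hy.
    assert (yr : Rabs y < r).
    { unfold Rmin, Rmax in Hy; destruct (Rle_dec 0 x); unfold Rabs in *;
      destruct (Rcase_abs x), (Rcase_abs y); lra. }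
    assert (HEy := HE y yr); auto_derive.
    + now exists (dE y).
    + rewrite_derivatives; ring.
  - intros y Hy.
    assert (yr : Rabs y < r).
    { unfold Rmin, Rmax in Hy; destruct (Rle_dec 0 x); unfold Rabs in *;
      destruct (Rcase_abs x), (Rcase_abs y); lra. }
    apply continuity_pt_filterlim, (ex_derive_continuous (fun x => E x * exp (- k * x))).
    assert (HEy := HE y yr); auto_derive; now exists (dE y).
  - exists y; split.
    + unfold Rmin, Rmax in Hy; destruct (Rle_dec 0 x); unfold Rabs in *; split; try nra;
      destruct (Rcase_abs x), (Rcase_abs y); lra.
    + cbv beta in Ey; rewrite E0 in Ey; lra. }
assert (small : E x <= 0); [|now apply Rle_antisym].
destruct (Rle_dec 0 x) as [x0|x0].
- destruct (mono K (or_introl Logic.eq_refl)) as [y [[_ yr] Ey]].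
  assert (dy := HK y yr); apply Rabs_le_between in dy.
  assert (e1 := exp_pos (- K * x)); assert (e2 := exp_pos (- K * y)).
  assert (0 <= (K * E y - dE y) * exp (- K * y)) by (apply Rmult_le_pos; lra).
  nra.
- destruct (mono (- K) (or_intror Logic.eq_refl)) as [y [[_ yr] Ey]].
  assert (dy := HK y yr); apply Rabs_le_between in dy.
  assert (e1 := exp_pos (- - K * x)); assert (e2 := exp_pos (- - K * y)).
  assert (0 <= (K * E y + dE y) * exp (- - K * y)) by (apply Rmult_le_pos; lra).
  nra.
Qed.

(* A and B are the even and odd parts of F, while U and H are the even and odd
   parts of the generating function of [true_ended] permutations. *)
Definition solves (A B H U : R -> R) (x : R) : Prop :=
  is_derive A x (A x * B x + H x) /\ is_derive B x (A x * A x) /\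
  is_derive H x (A x * U x) /\ is_derive U x (A x * H x).

Lemma locally_bounded (f : R -> R) (M : R) :
  continuous f 0 -> Rabs (f 0) < M -> locally 0 (fun x => Rabs (f x) < M).
Proof.
intros cf fM.
exact (continuous_comp f Rabs 0 cf (continuous_Rabs _) _ (open_lt M _ fM)).
Qed.

Lemma Rabs_mul_sqr (c M x y E : R) : Rabs c <= M -> x * x + y * y <= E -> Rabs (c * x * y) <= M * E.
Proof.
intros cM xyE; rewrite Rmult_assoc Rabs_mult.
apply Rmult_le_compat; auto using Rabs_pos.
apply Rabs_le; nra.
Qed.

(** The squared distance of the two solutions satisfies the Gronwall bound. Splitting A B - A2 B2 =
    A (B - B2) + B2 (A - A2), and likewise the other products, leaves as coefficients only 1, [A]
    and components of the second solution. *)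
Lemma solves_bounded_unique (A B H U A2 B2 H2 U2 : R -> R) (M r : R) :
  A 0 = A2 0 -> B 0 = B2 0 -> H 0 = H2 0 -> U 0 = U2 0 ->
  (forall x, Rabs x < r -> solves A B H U x /\ solves A2 B2 H2 U2 x) ->
  (forall x, Rabs x < r -> Rabs (A x) < M /\ Rabs (A2 x) < M /\ Rabs (B2 x) < M /\
     Rabs (H2 x) < M /\ Rabs (U2 x) < M) ->
  forall x, Rabs x < r -> A x = A2 x /\ B x = B2 x.
Proof.
intros a0 b0 h0 u0 sol bnd x xr.
set (E := fun x => (A x - A2 x) * (A x - A2 x) + (B x - B2 x) * (B x - B2 x)
  + (H x - H2 x) * (H x - H2 x) + (U x - U2 x) * (U x - U2 x)).
assert (E0 : E x = 0).
{ apply (gronwall_zero E (fun x =>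
    2 * (A x * (A x - A2 x) * (B x - B2 x) + B2 x * (A x - A2 x) * (A x - A2 x)
     + 1 * (A x - A2 x) * (H x - H2 x)
     + A x * (A x - A2 x) * (B x - B2 x) + A2 x * (A x - A2 x) * (B x - B2 x)
     + A x * (U x - U2 x) * (H x - H2 x) + U2 x * (A x - A2 x) * (H x - H2 x)
     + A x * (H x - H2 x) * (U x - U2 x) + H2 x * (A x - A2 x) * (U x - U2 x)))
    (* The derivative is twice a sum of nine products: eight coefficients are below [M] and one is
       1. The last factor 2 comes from bounding each product of two differences by twice the squared
       distance. *)
    (2 * (9 * M + 1) * 2) r); auto.
  - intros y yr.
    destruct (sol y yr) as [[dA [dB [dH dU]]] [dA2 [dB2 [dH2 dU2]]]].
    unfold E; auto_derive.
    + repeat split; eexists; eassumption.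
    + rewrite_derivatives; ring.
  - intros y yr; destruct (bnd y yr) as (mA & mA2 & mB2 & mH2 & mU2).
    unfold E; clear - mA mA2 mB2 mH2 mU2.
    set (a := A y - A2 y); set (b := B y - B2 y); set (h := H y - H2 y); set (u := U y - U2 y).
    set (e := a * a + b * b + h * h + u * u).
    assert (Rabs 1 <= 1) by (rewrite Rabs_R1; lra).
    assert (M0 := Rabs_pos (A y)).
    assert (ea : a * a + a * a <= 2 * e) by (unfold e; nra).
    assert (eab : a * a + b * b <= 2 * e) by (unfold e; nra).
    assert (eah : a * a + h * h <= 2 * e) by (unfold e; nra).
    assert (eau : a * a + u * u <= 2 * e) by (unfold e; nra).
    assert (ehu : h * h + u * u <= 2 * e) by (unfold e; nra).
    assert (euh : u * u + h * h <= 2 * e) by (unfold e; nra).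
    assert (e0 : 0 <= e) by (unfold e; nra).
    assert (t1 := Rabs_mul_sqr (A y) M a b _ (Rlt_le _ _ mA) eab).
    assert (t2 := Rabs_mul_sqr (B2 y) M a a _ (Rlt_le _ _ mB2) ea).
    assert (t3 := Rabs_mul_sqr 1 1 a h _ ltac:(assumption) eah).
    assert (t4 := Rabs_mul_sqr (A2 y) M a b _ (Rlt_le _ _ mA2) eab).
    assert (t5 := Rabs_mul_sqr (A y) M u h _ (Rlt_le _ _ mA) euh).
    assert (t6 := Rabs_mul_sqr (U2 y) M a h _ (Rlt_le _ _ mU2) eah).
    assert (t7 := Rabs_mul_sqr (A y) M h u _ (Rlt_le _ _ mA) ehu).
    assert (t8 := Rabs_mul_sqr (H2 y) M a u _ (Rlt_le _ _ mH2) eau).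
    assert (Me : 0 <= M * e) by (apply Rmult_le_pos; lra).
    apply Rabs_le_between in t1, t2, t3, t4, t5, t6, t7, t8.
    apply Rabs_le; lra.
  - intros y; unfold E; repeat apply Rplus_le_le_0_compat; apply Rle_0_sqr.
  - unfold E; rewrite a0 b0 h0 u0; ring. }
assert (pA := Rle_0_sqr (A x - A2 x)); assert (pB := Rle_0_sqr (B x - B2 x)).
assert (pH := Rle_0_sqr (H x - H2 x)); assert (pU := Rle_0_sqr (U x - U2 x)).
unfold E in E0; fold (Rsqr (A x - A2 x)) (Rsqr (B x - B2 x)) in E0.
fold (Rsqr (H x - H2 x)) (Rsqr (U x - U2 x)) in E0.
split; apply Rminus_diag_uniq, Rsqr_0_uniq; lra.
Qed.

(** Differentiability at 0 gives continuity there, hence a common bound [M] near 0. *)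
Lemma solves_unique (A B H U A2 B2 H2 U2 : R -> R) :
  A 0 = A2 0 -> B 0 = B2 0 -> H 0 = H2 0 -> U 0 = U2 0 ->
  locally 0 (solves A B H U) -> locally 0 (solves A2 B2 H2 U2) ->
  locally 0 (fun x => A x = A2 x /\ B x = B2 x).
Proof.
intros a0 b0 h0 u0 s1 s2.
destruct (locally_singleton _ _ s1) as [dA _].
destruct (locally_singleton _ _ s2) as [dA2 [dB2 [dH2 dU2]]].
set (M := 1 + Rabs (A 0) + Rabs (A2 0) + Rabs (B2 0) + Rabs (H2 0) + Rabs (U2 0)).
assert (bnd : forall (f : R -> R) (l : R), is_derive f 0 l -> Rabs (f 0) < M -> locally 0 (fun x => Rabs (f x) < M)).
{ intros f l df; apply locally_bounded, (ex_derive_continuous (V := R_NormedModule)); now exists l. }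
assert (pA := Rabs_pos (A 0)); assert (pA2 := Rabs_pos (A2 0)); assert (pB := Rabs_pos (B2 0)).
assert (pH := Rabs_pos (H2 0)); assert (pU := Rabs_pos (U2 0)).
assert (nA := bnd _ _ dA ltac:(unfold M; lra)).
assert (nA2 := bnd _ _ dA2 ltac:(unfold M; lra)).
assert (nB2 := bnd _ _ dB2 ltac:(unfold M; lra)).
assert (nH2 := bnd _ _ dH2 ltac:(unfold M; lra)).
assert (nU2 := bnd _ _ dU2 ltac:(unfold M; lra)).
destruct (filter_and _ _ (filter_and _ _ s1 s2) (filter_and _ _ nA (filter_and _ _ nA2
  (filter_and _ _ nB2 (filter_and _ _ nH2 nU2))))) as [r Hr].
exists r; intros x xr.
assert (br : forall y, Rabs y < r -> ball 0 r y).
{ intros y yr; change (Rabs (y - 0) < r); now rewrite Rminus_0_r. }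
apply (solves_bounded_unique A B H U A2 B2 H2 U2 M r); auto.
- intros y yr; apply (Hr y (br y yr)).
- intros y yr; apply (Hr y (br y yr)).
- change (Rabs (x - 0) < r) in xr; now rewrite Rminus_0_r in xr.
Qed.

(** * The closed form *)

Lemma is_derive_cosh (x : R) : is_derive cosh x (sinh x).
Proof. apply is_derive_Reals, derivable_pt_lim_cosh. Qed.
Lemma is_derive_sinh (x : R) : is_derive sinh x (cosh x).
Proof. apply is_derive_Reals, derivable_pt_lim_sinh. Qed.

Definition c_ (x : R) : R := cos (x / 2).
Definition s_ (x : R) : R := sin (x / 2).
Definition ch_ (x : R) : R := cosh (sqrt 3 * x / 2).
Definition sh_ (x : R) : R := sinh (sqrt 3 * x / 2).
Definition den (x : R) : R := 3 * c_ x ^ 2 - sh_ x ^ 2.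
(* den' = - (numerator of B_); the numerator of A_ has derivative that of H_. *)
Definition A_ (x : R) : R := (3 * ch_ x * c_ x + sqrt 3 * s_ x * sh_ x) / den x.
Definition B_ (x : R) : R := (3 * s_ x * c_ x + sqrt 3 * ch_ x * sh_ x) / den x.
Definition H_ (x : R) : R := 2 * sqrt 3 * c_ x * sh_ x / den x.
Definition U_ (x : R) : R := (3 * c_ x ^ 2 + sh_ x ^ 2) / den x.

Lemma is_derive_c x : is_derive c_ x (- s_ x / 2).
Proof. unfold c_, s_; auto_derive; trivial; unfold Rdiv; ring. Qed.
Lemma is_derive_s x : is_derive s_ x (c_ x / 2).
Proof. unfold c_, s_; auto_derive; trivial; unfold Rdiv; ring. Qed.
Lemma is_derive_ch x : is_derive ch_ x (sqrt 3 * sh_ x / 2).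
Proof.
unfold ch_, sh_.
replace (sqrt 3 * sinh (sqrt 3 * x / 2) / 2) with (scal (sqrt 3 / 2) (sinh (sqrt 3 * x / 2))).
2: { unfold scal; simpl; unfold mult; simpl; field. }
apply (is_derive_comp cosh (fun x => sqrt 3 * x / 2)); [apply is_derive_cosh|].
auto_derive; trivial; field.
Qed.
Lemma is_derive_sh x : is_derive sh_ x (sqrt 3 * ch_ x / 2).
Proof.
unfold ch_, sh_.
replace (sqrt 3 * cosh (sqrt 3 * x / 2) / 2) with (scal (sqrt 3 / 2) (cosh (sqrt 3 * x / 2))).
2: { unfold scal; simpl; unfold mult; simpl; field. }
apply (is_derive_comp sinh (fun x => sqrt 3 * x / 2)); [apply is_derive_sinh|].
auto_derive; trivial; field.
Qed.

Lemma closed_form_solves (x : R) : den x <> 0 -> solves A_ B_ H_ U_ x.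
Proof.
intros dx.
assert (dc := is_derive_c x); assert (ds := is_derive_s x).
assert (dC := is_derive_ch x); assert (dS := is_derive_sh x).
assert (q2 : sqrt 3 * sqrt 3 = 3) by (apply sqrt_sqrt; lra).
assert (cs : s_ x * s_ x = 1 - c_ x * c_ x).
{ assert (t := sin2_cos2 (x / 2)); unfold s_, c_, Rsqr in *; lra. }
assert (CS : ch_ x * ch_ x = 1 + sh_ x * sh_ x).
{ unfold ch_, sh_, cosh, sinh; assert (t := exp_plus (sqrt 3 * x / 2) (- (sqrt 3 * x / 2))).
  rewrite Rplus_opp_r exp_0 in t; lra. }
assert (dD : is_derive den x (- (3 * s_ x * c_ x + sqrt 3 * ch_ x * sh_ x))).
{ unfold den; auto_derive; [repeat split; eexists; eassumption|].
  rewrite_derivatives; field. }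
(* Quotient rule with denominators cleared; the plus sign reflects [dD]. What remains for each
   component is a polynomial identity modulo [q2], [cs] and [CS]. *)
assert (quot : forall N dN l, is_derive N x dN ->
   dN * den x + N x * (3 * s_ x * c_ x + sqrt 3 * ch_ x * sh_ x) = l * (den x * den x) ->
   is_derive (fun x => N x / den x) x l).
{ intros N dN l dN' e; auto_derive.
  - repeat split; trivial; eexists; eassumption.
  - rewrite_derivatives.
    apply (Rmult_eq_reg_r (den x * den x)); [|now apply Rmult_integral_contrapositive].
    rewrite -e; field; assumption. }
assert (dx' := dx); unfold den in dx'.
split; [|split; [|split]].
- apply (quot _ (2 * sqrt 3 * c_ x * sh_ x)).
  + auto_derive; [repeat split; eexists; eassumption|].
    rewrite_derivatives; field [q2].
  + unfold A_, B_, H_, den; field; assumption.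
- apply (quot _ (3 * (c_ x * c_ x + sh_ x * sh_ x))).
  + auto_derive; [repeat split; eexists; eassumption|].
    rewrite_derivatives; field [q2 cs CS].
  + unfold A_, den; field_simplify; [|assumption..]. ring [q2 cs CS].
- apply (quot _ (3 * c_ x * ch_ x - sqrt 3 * s_ x * sh_ x)).
  + auto_derive; [repeat split; eexists; eassumption|].
    rewrite_derivatives; field [q2 cs CS].
  + unfold A_, U_, den; field_simplify; [|assumption..]. ring [q2 cs CS].
- apply (quot _ (sqrt 3 * sh_ x * ch_ x - 3 * c_ x * s_ x)).
  + auto_derive; [repeat split; eexists; eassumption|].
    rewrite_derivatives; field [q2 cs CS].
  + unfold A_, H_, den; field_simplify; [|assumption..]. ring [q2 cs CS].
Qed.

(** The two numerators add up to (C + s)(3 c + sqrt 3 S), and 3 Q = (3 c - sqrt 3 S)(3 c + sqrt 3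
    S), so the second factor cancels. *)
Lemma A_plus_B (x : R) : den x <> 0 ->
  A_ x + B_ x = (3 * sin (x / 2) + 3 * cosh (sqrt 3 * x / 2)) /
         (3 * cos (x / 2) - sqrt 3 * sinh (sqrt 3 * x / 2)).
Proof.
assert (q2 : sqrt 3 * sqrt 3 = 3) by (apply sqrt_sqrt; lra).
intros dx; fold (c_ x) (s_ x) (ch_ x) (sh_ x).
assert (fac : (3 * c_ x - sqrt 3 * sh_ x) * (3 * c_ x + sqrt 3 * sh_ x) = 3 * den x) by (unfold den; ring [q2]).
assert (dx' : 3 * c_ x - sqrt 3 * sh_ x <> 0) by (intros e; rewrite e in fac; lra).
unfold A_, B_; apply (Rmult_eq_reg_r (3 * den x)); [|lra].
rewrite -{2}fac; field_simplify; [|assumption..]; ring [q2].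
Qed.

Lemma den_neq0_near : locally 0 (fun x => den x <> 0).
Proof.
assert (cd : continuous den 0).
{ apply (ex_derive_continuous (V := R_NormedModule)).
  unfold den; auto_derive; repeat split; eexists; [apply is_derive_c | apply is_derive_sh]. }
apply (cd (fun y => y <> 0)), (open_neq 0).
unfold den, c_, sh_; rewrite !Rmult_0_r !Rdiv_0_l cos_0 sinh_0; simpl; lra.
Qed.

Set Implicit Arguments. Unset Strict Implicit. Unset Printing Implicit Defensive.
Open Scope nat_scope.

(** * Cutting a permutation at its maximum *)

(* One bit per step of the word, p telling whether the current position is odd:
   the bit is false at an ascent from an odd position and at a descent from an
   even one (an alternating descent set, up to complement).  Reversing the order
   r is the same as flipping p. *)
Fixpoint steps (T : Type) (r : rel T) (p : bool) (w : seq T) : seq bool :=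
  if w is x :: w1 then
    if w1 is y :: _ then (r x y (+) p) :: steps r (~~ p) w1 else [::]
  else [::].

(* Two consecutive false bits are exactly a peak at an even position or a valley
   at an odd one. *)
Definition valid (T : Type) (r : rel T) (w : seq T) : bool :=
  sorted orb (steps r true w).

(* The valid words that stay valid when one more false bit is appended. *)
Definition true_ended (T : Type) (r : rel T) (w : seq T) : bool :=
  valid r w && last true (steps r true w).

(** A true bit is compatible with any neighbour, so it decouples the two sides. *)
Lemma sorted_orb_cat_true (s1 s2 : seq bool) :
  sorted orb (s1 ++ true :: s2) = sorted orb s1 && sorted orb s2.
Proof.
have tr s : path orb true s = sorted orb s by case: s.
case: s1 => [|a s1] /=; first exact: tr.
by rewrite cat_path /= tr orbT.
Qed.

Lemma sorted_orb_cat_false2 (s1 s2 : seq bool) :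
  sorted orb (s1 ++ [:: false, false & s2]) = false.
Proof. by case: s1 => //= a s1; rewrite cat_path /= !andbF. Qed.

(** The default [true] handles the empty list; for the same reason words of length at most one are
    [true_ended]. *)
Lemma sorted_orb_rcons_false (s : seq bool) :
  sorted orb (rcons s false) = sorted orb s && last true s.
Proof. by case: s => //= a s; rewrite rcons_path orbF. Qed.

Lemma steps_cat (T : Type) (r : rel T) p (l : seq T) m w :
  steps r p (rcons l m ++ w) =
  steps r p (rcons l m) ++ steps r (p (+) odd (size l)) (m :: w).
Proof.
elim: l p => [|x l IH] p; first by rewrite /= addbF.
have /= := IH (~~ p); case: l {IH} => [|y l] /= ->; congr (_ :: _).
  by rewrite addbF addbT.
suff -> : ~~ p (+) ~~ odd (size l) = p (+) ~~ ~~ odd (size l) by [].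
by case: p (odd _) => [] [].
Qed.

Lemma steps_rcons (T : Type) (r : rel T) p (l : seq T) m :
  0 < size l -> all (r^~ m) l ->
  steps r p (rcons l m) = rcons (steps r p l) (p (+) odd (size l)).
Proof.
elim: l p => // x l IH p _ /= /andP[rx rl].
case: l IH rl => [|y l] IH rl /=; first by rewrite rx addbC.
by have /= -> := IH (~~ p) isT rl; congr (_ :: rcons _ _); case: p (odd _) => [] [].
Qed.

(** To the right of a maximum at an odd position the word resumes at an even one; the flip lets this
    part be read from an odd position for the reversed order. *)
Lemma steps_flip (T : eqType) (r : rel T) p (w : seq T) :
  antisymmetric r -> total r -> uniq w ->
  steps r p w = steps (fun x y => r y x) (~~ p) w.
Proof.
move=> asym tot; elim: w p => // x [|y w] IH p //= /andP[xNw uw].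
have /= -> := IH (~~ p) uw; congr (_ :: _).
have xy : x != y by apply: contra xNw => /eqP ->; rewrite mem_head.
have := tot x y; have := asym x y.
by case: (r x y) (r y x) p => [] [] [] //= H; move: xy; rewrite H ?eqxx.
Qed.

Section Cut.
Variables (T : eqType) (r : rel T) (l w : seq T) (m : T).
Hypotheses (asym : antisymmetric r) (tot : total r).
Hypotheses (lm : all (r^~ m) l) (wm : all (r^~ m) w) (mw : m \notin w).
Hypothesis (uw : uniq w).

(** The ascent into [m] and the descent out of it start at positions of opposite parity, so both
    carry the bit [~~ odd (size l)]. Each is absent when the part on its side is empty. *)
Lemma steps_cut : steps r true (l ++ m :: w) =
  (if l is [::] then [::] else rcons (steps r true l) (~~ odd (size l)))
  ++ (if w is [::] then [::] else ~~ odd (size l) :: steps (fun x y => r y x) (~~ odd (size l)) w).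
Proof.
rewrite -cat_rcons steps_cat; congr (_ ++ _).
  by case: l lm => // x l' lm'; rewrite steps_rcons.
case: w wm mw uw => // x w' /= /andP[rxm _] mNw uxw.
have mx : r m x = false.
  by apply: contraNF mNw => rmx; rewrite (asym (x := m) (y := x)) ?mem_head // rmx.
rewrite mx; congr (_ :: _).
by have /= -> := @steps_flip _ r (~~ (true (+) odd (size l))) (x :: w') asym tot uxw; rewrite negbK.
Qed.

(* A maximum at an odd position is surrounded by true bits and at an even one by
   false bits, which is only possible at the end of the word. *)
Lemma valid_cut : valid r (l ++ m :: w) =
  if odd (size l) then nilp w && true_ended r l
  else valid r l && valid (fun x y => r y x) w.
Proof.
rewrite /true_ended /valid steps_cut.
case: ifP => lodd; last first.
  case: l => [|x l']; case: w => [|y w'] //=.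
  - exact: (sorted_orb_cat_true [::]).
  - by rewrite cats0 -cats1 sorted_orb_cat_true.
  - by rewrite cat_rcons sorted_orb_cat_true [sorted _ (true :: _)](sorted_orb_cat_true [::]).
case: l lodd => [|x l'] // _; case: w => [|y w'].
  by rewrite cats0 sorted_orb_rcons_false.
by rewrite cat_rcons sorted_orb_cat_false2.
Qed.

(** A maximum at an even position closes a valid word with a false bit. At an odd position the last
    bit is that of [w], or the true bit next to [m] (or the default) if [w] has no step. *)
Lemma true_ended_cut : true_ended r (l ++ m :: w) =
  ~~ odd (size l) && (valid r l && true_ended (fun x y => r y x) w).
Proof.
rewrite /true_ended valid_cut /true_ended /nilp; case: ifP => lodd; rewrite steps_cut lodd.
  case: l lodd => // x l' _; case: w => [|y w'] //=.
  by rewrite cats0 last_rcons andbF.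
by case: l => [|x l']; case: w => [|y w']; rewrite /= ?cats0 ?last_cat ?last_rcons ?andbT // andbA.
Qed.
End Cut.

(** * Counting words by the letter set of the left part *)

Definition splits (T : finType) (m : T) (A : {set T}) : seq (seq T) :=
  [seq x.1 ++ m :: x.2 | B <- enum (powerset A),
     x <- [seq (l, w) | l <- permutations (enum B), w <- permutations (enum (A :\: B))]].

(** There are no repetitions: the index of [m] determines the cut, and the letters of the left part
    determine [B]. *)
Lemma perm_eq_splits (T : finType) (m : T) (A : {set T}) : m \notin A ->
  perm_eq (permutations (enum (m |: A))) (splits m A).
Proof.
move=> mA.
have memP (B : {set T}) (u : seq T) : u \in permutations (enum B) -> u =i B.
  by rewrite mem_permutations => /perm_mem uB x; rewrite uB mem_enum.
apply: uniq_perm; first exact: permutations_uniq.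
  apply: allpairs_uniq_dep; first exact: enum_uniq.
    move=> B _; apply: allpairs_uniq; try exact: permutations_uniq.
    by move=> [? ?] [? ?] _ _ [-> ->].
  move=> z z' /allpairsPdep[B [_ [BA /allpairsP[[l w] /= [lB wB ->]] ->]]].
  move=> /allpairsPdep[B' [_ [BA' /allpairsP[[l' w'] /= [lB' wB' ->]] ->]]] /= E.
  have mNl (C : {set T}) u : C \in enum (powerset A) -> u \in permutations (enum C) -> m \notin u.
    rewrite mem_enum powersetE => /subsetP CA /memP uC; rewrite uC.
    by apply: contra mA => /CA.
  have idx u v : m \notin u -> index m (u ++ m :: v) = size u.
    by move=> mu; rewrite index_cat (negPf mu) /= eqxx addn0.
  have sz : size l = size l'.
    by have := congr1 (index m) E; rewrite !idx //; [exact: mNl lB' | exact: mNl lB].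
  move/eqP: E; rewrite eqseq_cat // eqseq_cons => /and3P[/eqP ll _ /eqP ww].
  subst l' w'; suff -> : B = B' by [].
  by apply/setP => x; rewrite -(memP _ _ lB) (memP _ _ lB').
move=> u; rewrite mem_permutations; apply/idP/idP.
  move=> uA; have mu : m \in u by rewrite (perm_mem uA) mem_enum setU11.
  have uu : uniq u by rewrite (perm_uniq uA) enum_uniq.
  case/splitPr: mu uA uu => l w uA uu.
  move: (uu); rewrite cat_uniq /= negb_or => /and4P[ul /andP[ml hlw] mw uw].
  have lwA x : (x \in l) || (x \in w) = (x \in A).
    have := perm_mem uA x; rewrite mem_cat in_cons mem_enum in_setU1.
    case: (eqVneq x m) => [-> _|//]; by rewrite (negPf ml) (negPf mw) (negPf mA).
  apply/allpairsPdep; exists [set x in l], (l, w); split => //.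
    by rewrite mem_enum powersetE; apply/subsetP => x; rewrite inE -lwA => ->.
  apply/allpairsP; exists (l, w); split=> //=; rewrite mem_permutations;
    apply: uniq_perm => //; try exact: enum_uniq.
    by move=> x; rewrite mem_enum inE.
  move=> x; rewrite mem_enum !inE -lwA; case: (boolP (x \in l)) => //= xl.
  by apply: contraNF hlw => xw; apply/hasP; exists x.
case/allpairsPdep => B [_ [BA /allpairsP[[l w] /= [lB wB ->]] ->]] /=.
move: BA; rewrite mem_enum powersetE => /subsetP BA.
have /andP[ul uw] : uniq l && uniq w.
  by move: lB wB; rewrite !mem_permutations => /perm_uniq -> /perm_uniq ->; rewrite !enum_uniq.
apply: uniq_perm; rewrite ?enum_uniq //.
  rewrite cat_uniq ul /= uw (memP _ _ wB) inE (negPf mA) andbF andbT /=.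
  rewrite negb_or (memP _ _ lB) (contra (BA m) mA) /=.
  by rewrite andbT; apply/hasPn => x; rewrite (memP _ _ wB) inE /= (memP _ _ lB) => /andP[].
move=> x; rewrite mem_cat in_cons mem_enum in_setU1 (memP _ _ lB) (memP _ _ wB) !inE.
case: eqP => [|_]; first by rewrite orbT.
by case: (boolP (x \in B)) => //= /BA ->.
Qed.

Lemma count_splits (T : finType) (m : T) (A : {set T}) (a : pred (seq T)) : m \notin A ->
  count a (permutations (enum (m |: A))) =
  \sum_(B in powerset A) \sum_(l <- permutations (enum B))
     count (fun w => a (l ++ m :: w)) (permutations (enum (A :\: B))).
Proof.
move=> mA; rewrite (seq.permP (perm_eq_splits mA)) -sum1_count big_mkcond big_allpairs_dep.
rewrite big_enum; apply: eq_bigr => B _.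
rewrite big_allpairs_dep; apply: eq_bigr => l _.
by rewrite -sum1_count [RHS]big_mkcond.
Qed.

Lemma sum_powerset (T : finType) (A : {set T}) (F : nat -> nat) :
  \sum_(B in powerset A) F #|B| = \sum_(k < #|A|.+1) 'C(#|A|, k) * F k.
Proof.
rewrite (partition_big (fun B : {set T} => inord #|B| : 'I_#|A|.+1) xpredT) //=.
apply: eq_bigr => k _; rewrite -cards_draws -[X in _ = X * _]sum1_card big_distrl /=.
have cardE (B : {set T}) : B \subset A -> (inord #|B| == k) = (#|B| == k).
  move=> BA; rewrite -val_eqE /= inordK // ltnS; exact: subset_leq_card.
apply: eq_big => [B|B]; rewrite !inE; first by apply: andb_id2l => /cardE.
by case/andP=> BA; rewrite cardE // mul1n => /eqP ->.
Qed.

Definition nvalid (T : finType) (r : rel T) (A : {set T}) : nat :=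
  count (valid r) (permutations (enum A)).
Definition ntrue_ended (T : finType) (r : rel T) (A : {set T}) : nat :=
  count (true_ended r) (permutations (enum A)).

Lemma count_andb (T : Type) (b : bool) (a : pred T) (s : seq T) :
  count (fun x => b && a x) s = b * count a s.
Proof. by case: b => /=; rewrite ?mul1n ?count_pred0. Qed.

Lemma sum_count (T : Type) (a : pred T) (s : seq T) (k : nat) :
  \sum_(x <- s) a x * k = count a s * k.
Proof. by rewrite -big_distrl -sum1_count [in RHS]big_mkcond. Qed.

(** Turns the condition [nilp w] of [valid_cut] into one on the letter set of [w]. *)
Lemma count_nilp (T : finType) (D : {set T}) : count (@nilp T) (permutations (enum D)) = (D == set0).
Proof.
case: eqP => [->|/eqP D0].
  by rewrite enum_set0 /permutations /=.
apply/eqP; rewrite eqn0Ngt -has_count; apply/hasP => -[w].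
rewrite mem_permutations => /perm_size; rewrite -cardE => + /eqP w0.
by rewrite w0 => /esym/eqP; rewrite cards_eq0 (negPf D0).
Qed.

Section Recurrence.
Variables (T : finType) (r : rel T) (m : T) (A : {set T}).
Hypotheses (asym : antisymmetric r) (tot : total r).
Hypotheses (mA : m \notin A) (max : {in A, forall x, r x m}).

Let side (B : {set T}) (u : seq T) : B \subset A -> u \in permutations (enum B) ->
  [/\ all (r^~ m) u, uniq u, m \notin u & size u = #|B|].
Proof.
rewrite mem_permutations => /subsetP BA uB; split.
- by apply/allP => x; rewrite (perm_mem uB) mem_enum => /BA/max.
- by rewrite (perm_uniq uB) enum_uniq.
- by rewrite (perm_mem uB) mem_enum; apply: contra mA => /BA.
- by rewrite (perm_size uB) cardE.
Qed.

Lemma nvalidU1 : nvalid r (m |: A) =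
  \sum_(B in powerset A)
    (if odd #|B| then ntrue_ended r B * (A :\: B == set0)
     else nvalid r B * nvalid (fun x y => r y x) (A :\: B)).
Proof.
rewrite /nvalid count_splits //; apply: eq_bigr => B; rewrite powersetE => BA.
rewrite -!sum_count (fun_if (fun x => \sum_(l <- _) _ = x)).
suff E l : l \in permutations (enum B) ->
    count (fun w => valid r (l ++ m :: w)) (permutations (enum (A :\: B))) =
    if odd #|B| then true_ended r l * (A :\: B == set0)
    else valid r l * count (valid (fun x y => r y x)) (permutations (enum (A :\: B))).
  by case: ifP E => _ E; rewrite big_seq [RHS]big_seq; apply: eq_bigr => l /E.
move=> lB; have [al ul ml <-] := side BA lB.
rewrite -count_nilp -!count_andb -(fun_if (fun a => count a _)).
apply: eq_in_count => w /(side (subsetDl _ _))[aw uw mw _].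
by rewrite valid_cut //; case: ifP => // _; rewrite andbC.
Qed.

Lemma ntrue_endedU1 : ntrue_ended r (m |: A) =
  \sum_(B in powerset A)
    ~~ odd #|B| * (nvalid r B * ntrue_ended (fun x y => r y x) (A :\: B)).
Proof.
rewrite /ntrue_ended count_splits //; apply: eq_bigr => B; rewrite powersetE => BA.
rewrite -sum_count big_distrr big_seq [RHS]big_seq; apply: eq_bigr => l lB /=.
have [al ul ml <-] := side BA lB; rewrite -!count_andb.
apply: eq_in_count => w /(side (subsetDl _ _))[aw uw mw _].
by rewrite true_ended_cut.
Qed.
End Recurrence.

Lemma exists_max (T : finType) (r : rel T) (A : {set T}) :
  transitive r -> total r -> A != set0 -> exists2 m, m \in A & {in A, forall x, r x m}.
Proof.
move=> tr tot /set0Pn[x0 x0A].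
have sorted_A := sort_sorted tot (enum A).
have mem_A : sort r (enum A) =i A by move=> x; rewrite mem_sort mem_enum.
case/lastP: (sort r (enum A)) sorted_A mem_A => [|s m] sorted_s mem_s.
  by move: x0A; rewrite -mem_s.
exists m; first by rewrite -mem_s mem_rcons mem_head.
move=> x; rewrite -mem_s mem_rcons inE => /predU1P[->|xs]; first by have := tot m m; rewrite orbb.
(* Reversal brings the last letter [m] to the head, where [path_sortedE] compares it with all
   others. *)
have := sorted_s; rewrite -cats1 -[s]revK -[[:: m]]revK -rev_cat rev_sorted /=.
rewrite path_sortedE; last by move=> a b c /[swap]; apply: tr.
by case/andP=> /allP + _; apply; rewrite mem_rev.
Qed.

Lemma nvalid0 (T : finType) (r : rel T) : nvalid r set0 = 1.
Proof. by rewrite /nvalid enum_set0 /permutations /=. Qed.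

Lemma ntrue_ended0 (T : finType) (r : rel T) : ntrue_ended r set0 = 1.
Proof. by rewrite /ntrue_ended enum_set0 /permutations /=. Qed.

(** * Reduction to integer sequences and their recurrence *)

Definition ord_nvalid (n : nat) : nat := nvalid (fun i j : 'I_n => i <= j) setT.
Definition ord_ntrue_ended (n : nat) : nat := ntrue_ended (fun i j : 'I_n => i <= j) setT.

(* All orders on all finite types are treated at once: the right part of a cut is
   counted for the reversed order. *)
Lemma recurrence_of_card (T : finType) (r : rel T) (A : {set T}) (n : nat) (F G : nat -> nat) :
  antisymmetric r -> total r -> transitive r -> #|A| = n.+1 ->
  (forall (s : rel T) (B : {set T}), antisymmetric s -> total s -> transitive s ->
     #|B| <= n -> nvalid s B = F #|B| /\ ntrue_ended s B = G #|B|) ->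
  nvalid r A = \sum_(k < n.+1) 'C(n, k) * (if odd k then G k * (n == k) else F k * F (n - k)) /\
  ntrue_ended r A = \sum_(k < n.+1) 'C(n, k) * (~~ odd k * (F k * G (n - k))).
Proof.
move=> asym tot tr An FG.
have [m mA max] : exists2 m, m \in A & {in A, forall x, r x m}.
  by apply: exists_max => //; rewrite -card_gt0 An.
have cA : #|A :\ m| = n by apply/eqP; rewrite -eqSS -An (cardsD1 m A) mA.
have mA' : m \notin A :\ m by rewrite !inE eqxx.
have max' : {in A :\ m, forall x, r x m} by move=> x; rewrite inE => /andP[_ /max].
have cB (B : {set T}) : B \in powerset (A :\ m) ->
    [/\ #|B| <= n, #|(A :\ m) :\: B| <= n & #|(A :\ m) :\: B| = n - #|B|].
  rewrite powersetE => BA; rewrite -cA; split; try exact: subset_leq_card.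
    by rewrite subset_leq_card // subsetDl.
  by rewrite cardsD (setIidPr BA).
have asym' : antisymmetric (fun x y => r y x) by move=> x y /andP[? ?]; apply: asym; apply/andP.
have tot' : total (fun x y => r y x) by move=> x y; apply: tot.
have tr' : transitive (fun x y => r y x) by move=> x y z /[swap]; apply: tr.
have cAE := sum_powerset (A :\ m); rewrite cA in cAE.
rewrite -(setD1K mA) nvalidU1 // ntrue_endedU1 //.
rewrite -(cAE (fun k => if odd k then G k * (n == k) else F k * F (n - k))).
rewrite -(cAE (fun k => ~~ odd k * (F k * G (n - k)))).
split; apply: eq_bigr => B /cB[Bn Dn DE].
  have [-> ->] := FG r B asym tot tr Bn; have [-> _] := FG _ _ asym' tot' tr' Dn.
  rewrite -cards_eq0 DE subn_eq0 eqn_leq Bn andbT; by [].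
by have [-> _] := FG r B asym tot tr Bn; have [_ ->] := FG _ _ asym' tot' tr' Dn; rewrite DE.
Qed.

Section LeqOrd.
Variable n : nat.
Lemma leq_ord_anti : antisymmetric (fun i j : 'I_n => i <= j).
Proof. by move=> i j /anti_leq/val_inj. Qed.
Lemma leq_ord_total : total (fun i j : 'I_n => i <= j).
Proof. by move=> i j; apply: leq_total. Qed.
Lemma leq_ord_trans : transitive (fun i j : 'I_n => i <= j).
Proof. by move=> i j k; apply: leq_trans. Qed.
End LeqOrd.

(** Induction on a bound for the cardinality, over all types at once: [A] and the ordinals with
    their usual order obey the same recurrence in terms of smaller sets. *)
Lemma nvalid_card (T : finType) (r : rel T) (A : {set T}) :
  antisymmetric r -> total r -> transitive r ->
  nvalid r A = ord_nvalid #|A| /\ ntrue_ended r A = ord_ntrue_ended #|A|.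
Proof.
move: {2}(#|A|) (leqnn #|A|) => n; elim: n T r A => [|n IH] T r A An asym tot tr.
  move: An; rewrite leqn0 cards_eq0 => /eqP ->.
  rewrite cards0 /ord_nvalid /ord_ntrue_ended nvalid0 ntrue_ended0.
  have -> : [set: 'I_0] = set0 by apply/setP => -[].
  by rewrite nvalid0 ntrue_ended0.
have [An'|nA] := leqP #|A| n; first exact: IH.
have {An nA} cA : #|A| = n.+1 by apply/eqP; rewrite eqn_leq An.
have [-> ->] := recurrence_of_card asym tot tr cA
  (fun s B hs ts ss Bn => IH T s B Bn hs ts ss).
have cI : #|[set: 'I_n.+1]| = n.+1 by rewrite cardsT card_ord.
have [<- <-] := recurrence_of_card (@leq_ord_anti _) (@leq_ord_total _) (@leq_ord_trans _) cI
  (fun s B hs ts ss Bn => IH _ s B Bn hs ts ss).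
by rewrite cA.
Qed.

Lemma ord_recurrence (n : nat) :
  ord_nvalid n.+1 = \sum_(k < n.+1) 'C(n, k) * (~~ odd k * (ord_nvalid k * ord_nvalid (n - k)))
     + odd n * ord_ntrue_ended n /\
  ord_ntrue_ended n.+1 =
    \sum_(k < n.+1) 'C(n, k) * (~~ odd k * (ord_nvalid k * ord_ntrue_ended (n - k))).
Proof.
have cI : #|[set: 'I_n.+1]| = n.+1 by rewrite cardsT card_ord.
have [E1 E2] := recurrence_of_card (@leq_ord_anti _) (@leq_ord_total _) (@leq_ord_trans _) cI
  (fun s B hs ts ss _ => @nvalid_card _ s B hs ts ss).
split; last exact: E2.
(* Among the odd [k] only [k = n] survives, with binomial coefficient 1. *)
rewrite [LHS]E1; have -> : odd n * ord_ntrue_ended n =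
    \sum_(k < n.+1) 'C(n, k) * (odd k * (ord_ntrue_ended k * (n == k))).
  rewrite big_ord_recr /= binn eqxx mul1n muln1 big1 ?add0n // => k _.
  by rewrite gtn_eqF // !muln0.
rewrite -big_split; apply: eq_bigr => k _ /=; rewrite -mulnDr.
by case: (odd k); rewrite /= ?mul0n ?mul1n ?addn0.
Qed.

Lemma ord_base : ord_nvalid 0 = 1 /\ ord_ntrue_ended 0 = 1.
Proof.
rewrite /ord_nvalid /ord_ntrue_ended.
have -> : [set: 'I_0] = set0 by apply/setP => -[].
by rewrite nvalid0 ntrue_ended0.
Qed.

Lemma ord_nvalid_le n : ord_nvalid n <= n`!.
Proof.
rewrite /ord_nvalid /nvalid (leq_trans (count_size _ _)) //.
by rewrite size_permutations ?enum_uniq // -cardE cardsT card_ord.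
Qed.

Lemma ord_ntrue_ended_le n : ord_ntrue_ended n <= n`!.
Proof.
rewrite /ord_ntrue_ended /ntrue_ended (leq_trans (count_size _ _)) //.
by rewrite size_permutations ?enum_uniq // -cardE cardsT card_ord.
Qed.

(** * From step bits to peaks and valleys of permutations *)

Lemma nth_steps (T : Type) (r : rel T) x0 p (w : seq T) i : i.+1 < size w ->
  nth false (steps r p w) i = r (nth x0 w i) (nth x0 w i.+1) (+) (p (+) odd i).
Proof.
elim: w p i => // x [|y w] IH p [|i] //= iw; first by rewrite addbF.
by have /= -> := IH (~~ p) i iw; case: p (odd i) => [] [].
Qed.

Lemma size_steps (T : Type) (r : rel T) p (w : seq T) : size (steps r p w) = (size w).-1.
Proof. by elim: w p => // x [|y w] IH p //=; have /= -> := IH (~~ p). Qed.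

Lemma valleys_even_peaks_oddE (n : nat) (s : 'S_n) :
  valleys_even_peaks_odd s = valid leq (word s).
Proof.
have szw : size (word s) = n by rewrite size_map size_enum_ord.
have uw : uniq (word s).
  by rewrite (map_inj_uniq (f := fun i => val (s i))) ?enum_uniq // => i j /val_inj/perm_inj.
have neq i j : i < n -> j < n -> i != j -> nth 0 (word s) i != nth 0 (word s) j.
  by move=> ? ?; rewrite nth_uniq ?szw.
apply/forallP/(sortedP false) => [H i|H [i /= _]].
  rewrite size_steps szw => i1.
  rewrite !(nth_steps _ 0) ?szw; [|lia|lia].
  (* Bits [i] and [i.+1] compare the letters of 0-based indices [i], [i.+1], [i.+2]; the middle one
     has 1-based position [i.+2]. *)
  have i2n : i.+2 < n.+1 by lia.
  have := H (Ordinal i2n); rewrite /is_valley /is_peak /= szw subn2 subn1 /=.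
  (* Distinct letters make the [leq] of the bits agree with the strict comparisons of peaks and
     valleys. *)
  have := @neq i i.+1 _ _ _; have := @neq i.+1 i.+2 _ _ _.
  set a := nth _ _ i; set b := nth _ _ i.+1; set c := nth _ _ i.+2.
  lia.
have [i2|] := leqP 2 i; last by rewrite /is_valley /is_peak; lia.
have [iw|] := leqP i (size (word s)).-1; last by rewrite /is_valley /is_peak; lia.
have := H (i - 2); rewrite size_steps !(nth_steps _ 0) ?szw; [|lia|lia].
rewrite /is_valley /is_peak.
have -> : (i - 2).+1 = i - 1 by lia.
have -> : (i - 1).+1 = i by lia.
lia.
Qed.

Lemma steps_map (T U : Type) (h : U -> T) (r : rel T) p (w : seq U) :
  steps r p (map h w) = steps (fun x y => r (h x) (h y)) p w.
Proof. by elim: w p => // x [|y w] IH p //=; have /= -> := IH (~~ p). Qed.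

Lemma f_countE n : f_count n = ord_nvalid n.
Proof.
pose line (s : 'S_n) := [seq s i | i <- enum 'I_n].
have line_inj : injective line.
  by move=> s t /eq_in_map E; apply/permP => i; apply: E; rewrite mem_enum.
have lineP : perm_eq [seq line s | s <- enum 'S_n] (permutations (enum [set: 'I_n])).
  have un : uniq [seq line s | s <- enum 'S_n] by rewrite map_inj_uniq ?enum_uniq.
  have sub : {subset [seq line s | s <- enum 'S_n] <= permutations (enum [set: 'I_n])}.
    move=> _ /mapP[s _ ->]; rewrite mem_permutations; apply: uniq_perm.
    - by rewrite map_inj_uniq ?enum_uniq //; apply: perm_inj.
    - exact: enum_uniq.
    move=> i; rewrite mem_enum inE; apply/mapP; exists (s^-1%g i); rewrite ?mem_enum //.
    by rewrite permKV.
  (* Both lists have n! entries, so the inclusion is an equality. *)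
  have [|_ e] := uniq_min_size un sub.
    by rewrite size_map size_permutations ?enum_uniq // -!cardE cardsT card_ord card_Sn.
  exact: uniq_perm un (permutations_uniq _) e.
rewrite /f_count /ord_nvalid /nvalid -(seq.permP lineP) count_map -size_filter cardsE cardE.
rewrite /enum_mem -!filter_predI !size_filter.
apply: eq_count => s; rewrite /= inE andbT.
transitivity (valleys_even_peaks_odd s) => //; rewrite valleys_even_peaks_oddE.
have -> : word s = map val (line s) by rewrite -map_comp.
by rewrite /valid steps_map.
Qed.

(** * Exponential generating functions *)

Open Scope R_scope.

Definition even_part (c : nat -> R) (n : nat) : R := if odd n then 0 else c n.
Definition odd_part (c : nat -> R) (n : nat) : R := if odd n then c n else 0.

Lemma CV_radius_ge1 (c : nat -> R) (x : R) :
  (forall n, Rabs (c n) <= 1) -> Rabs x < 1 -> Rbar_lt (Rabs x) (CV_radius c).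
Proof.
intros c1 x1; apply (Rbar_lt_le_trans _ (Rbar.Finite 1)); [exact x1|].
apply (proj1 (CV_radius_bounded c)); exists 1; intros n.
by rewrite pow1 Rmult_1_r.
Qed.

Lemma sum_f_R0_0 (F : nat -> R) n : (forall k, (k <= n)%coq_nat -> F k = 0) -> sum_f_R0 F n = 0.
Proof.
move=> F0; rewrite (PartSum.sum_eq _ (fun=> 0)) //; elim: n {F0} => //= n ->; lra.
Qed.

(** For even [k], [n - k] has the parity of [n]: the parity of the output index selects the part of
    [d] that contributes. *)
Lemma PS_mult_even_even (c d : nat -> R) n :
  PS_mult (even_part c) (even_part d) n = even_part (PS_mult (even_part c) d) n.
Proof.
rewrite /PS_mult {3}/even_part; case: ifP => on; [apply: sum_f_R0_0|apply: PartSum.sum_eq] => k kn;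
  rewrite /even_part; case: ifP => ok; rewrite ?Rmult_0_l ?minusE //.
  have -> : odd (n - k)%N by lia.
  by rewrite Rmult_0_r.
by have -> : odd (n - k)%N = false by lia.
Qed.

Lemma PS_mult_even_odd (c d : nat -> R) n :
  PS_mult (even_part c) (odd_part d) n = odd_part (PS_mult (even_part c) d) n.
Proof.
rewrite /PS_mult {2}/odd_part; case: ifP => on; [apply: PartSum.sum_eq|apply: sum_f_R0_0] => k kn;
  rewrite /even_part /odd_part; case: ifP => ok; rewrite ?Rmult_0_l ?minusE //.
  by have -> : odd (n - k)%N by lia.
have -> : odd (n - k)%N = false by lia.
by rewrite Rmult_0_r.
Qed.

Lemma factE n : fact n = n`!%N.
Proof. by elim: n => //= n ->; rewrite factS mulSn. Qed.

Definition egf (a : nat -> nat) (n : nat) : R := INR (a n) / INR (fact n).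

Lemma egf_bounded (a : nat -> nat) n : (a n <= n`!)%N -> Rabs (egf a n) <= 1.
Proof.
move=> an; have fp : 0 < INR (fact n) by apply: INR_fact_lt_0.
rewrite /egf Rabs_pos_eq; last by apply: Rdiv_le_0_compat => //; apply: pos_INR.
by apply/Rle_div_l => //; rewrite Rmult_1_l factE; apply: le_INR; apply/leP.
Qed.

(** The factorials absorb the binomial coefficient, and [even_part] the restriction to even [k]. *)
Lemma egf_convolution (a b : nat -> nat) n :
  INR (\sum_(k < n.+1) 'C(n, k) * (~~ odd k * (a k * b (n - k)))) / INR (fact n) =
  PS_mult (even_part (egf a)) (egf b) n.
Proof.
have INR_sum (F : nat -> nat) m : INR (\sum_(k < m.+1) F k) = sum_f_R0 (fun k => INR (F k)) m.
  elim: m => [|m IH]; first by rewrite big_ord_recl big_ord0 addn0.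
  by rewrite big_ord_recr /= plus_INR IH.
rewrite (INR_sum (fun k => 'C(n, k) * (~~ odd k * (a k * b (n - k))))%N) /Rdiv Rmult_comm scal_sum.
apply: PartSum.sum_eq => k /leP kn; rewrite /even_part /egf; case: ifP => ok /=.
  by rewrite mul0n muln0 /=; lra.
rewrite mul1n !mult_INR minusE.
have fn := INR_fact_neq_0 n; have fk := INR_fact_neq_0 k; have fnk := INR_fact_neq_0 (n - k).
have := congr1 INR (bin_fact kn); rewrite -!factE !mult_INR => e.
have -> : INR 'C(n, k) = INR (fact n) / (INR (fact k) * INR (fact (n - k))).
  by rewrite -e; field.
by field.
Qed.

Lemma PS_derive_egf (a : nat -> nat) n : PS_derive (egf a) n = INR (a n.+1) / INR (fact n).
Proof.
rewrite /PS_derive /egf; have -> : fact n.+1 = (n.+1 * fact n)%N by [].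
rewrite mult_INR; have := INR_fact_neq_0 n; have : INR n.+1 <> 0 by apply: not_0_INR.
by move=> ? ?; field.
Qed.

Section Generating.
Variables f g : nat -> nat.
Hypotheses (fle : forall n, (f n <= n`!)%N) (gle : forall n, (g n <= n`!)%N).
Hypothesis frec : forall n, f n.+1 =
  (\sum_(k < n.+1) 'C(n, k) * (~~ odd k * (f k * f (n - k))) + odd n * g n)%N.
Hypothesis grec : forall n, g n.+1 =
  (\sum_(k < n.+1) 'C(n, k) * (~~ odd k * (f k * g (n - k))))%N.

(** The derivative shifts the index by one, so the even part is read off at odd [n], exactly where
    the term [g n] of [frec] is present. *)
Lemma PS_derive_even_f : PS_derive (even_part (egf f)) =1
  PS_plus (PS_mult (even_part (egf f)) (odd_part (egf f))) (odd_part (egf g)).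
Proof.
move=> n; rewrite /PS_plus PS_mult_even_odd /odd_part.
have := PS_derive_egf f n; rewrite /PS_derive /even_part /=.
case: (odd n) (frec n) => /= e; last by move=> _; rewrite Rmult_0_r /plus /=; lra.
by move=> ->; rewrite e mul1n plus_INR Rdiv_plus_distr egf_convolution.
Qed.

Lemma PS_derive_odd_f : PS_derive (odd_part (egf f)) =1
  PS_mult (even_part (egf f)) (even_part (egf f)).
Proof.
move=> n; rewrite PS_mult_even_even /even_part.
have := PS_derive_egf f n; rewrite /PS_derive /odd_part /=.
case: (odd n) (frec n) => /= e; first by move=> _; rewrite Rmult_0_r.
by move=> ->; rewrite e mul0n addn0 egf_convolution.
Qed.

Lemma PS_derive_odd_g : PS_derive (odd_part (egf g)) =1
  PS_mult (even_part (egf f)) (even_part (egf g)).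
Proof.
move=> n; rewrite PS_mult_even_even /even_part.
have := PS_derive_egf g n; rewrite /PS_derive /odd_part /=.
case: (odd n) => /=; first by move=> _; rewrite Rmult_0_r.
by move=> ->; rewrite grec egf_convolution.
Qed.

Lemma PS_derive_even_g : PS_derive (even_part (egf g)) =1
  PS_mult (even_part (egf f)) (odd_part (egf g)).
Proof.
move=> n; rewrite PS_mult_even_odd /odd_part.
have := PS_derive_egf g n; rewrite /PS_derive /even_part /=.
case: (odd n) => /=; last by move=> _; rewrite Rmult_0_r.
by move=> ->; rewrite grec egf_convolution.
Qed.

Lemma parity_radius (a : nat -> nat) (x : R) : (forall n, (a n <= n`!)%N) -> Rabs x < 1 ->
  Rbar_lt (Rabs x) (CV_radius (even_part (egf a))) /\
  Rbar_lt (Rabs x) (CV_radius (odd_part (egf a))).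
Proof.
move=> ale x1; split; apply: CV_radius_ge1 => // n; have := egf_bounded (ale n);
  rewrite /even_part /odd_part; case: ifP => // _ _; rewrite Rabs_R0; lra.
Qed.

Lemma generating_solves (x : R) : Rabs x < 1 ->
  solves (PSeries (even_part (egf f))) (PSeries (odd_part (egf f)))
         (PSeries (odd_part (egf g))) (PSeries (even_part (egf g))) x.
Proof.
move=> x1; have [ra rb] := parity_radius fle x1; have [ru rh] := parity_radius gle x1.
rewrite /solves -!PSeries_mult // -PSeries_plus; first last.
- exact: CV_radius_inside.
- exact: ex_pseries_mult.
rewrite -(PSeries_ext _ _ x PS_derive_even_f) -(PSeries_ext _ _ x PS_derive_odd_f).
rewrite -(PSeries_ext _ _ x PS_derive_odd_g) -(PSeries_ext _ _ x PS_derive_even_g).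
by repeat (split; [exact: is_derive_PSeries|]); apply: is_derive_PSeries.
Qed.

Lemma infinite_sum_egf (x : R) : Rabs x < 1 ->
  infinite_sum (fun n => INR (f n) * x ^ n / INR (fact n))
    (PSeries (even_part (egf f)) x + PSeries (odd_part (egf f)) x).
Proof.
move=> x1; have [ra rb] := parity_radius fle x1.
have [ea eb] := (CV_radius_inside _ _ ra, CV_radius_inside _ _ rb).
apply/is_series_Reals; rewrite -PSeries_plus //.
have := PSeries_correct _ _ (ex_pseries_plus _ _ _ ea eb); move/is_pseries_R.
apply: is_series_ext => n; rewrite /PS_plus /even_part /odd_part /egf /plus /=.
by case: (odd n); rewrite /Rdiv; ring.
Qed.
End Generating.

(** * Identification of the series with the closed form *)

Theorem theorem1 :
  exists r : R, 0 < r /\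
    forall x : R, Rabs x < r ->
      infinite_sum (fun n : nat => INR (f_count n) * x ^ n / INR (fact n))
        ((3 * sin (x / 2) + 3 * cosh (sqrt 3 * x / 2)) /
         (3 * cos (x / 2) - sqrt 3 * sinh (sqrt 3 * x / 2))).
Proof.
have [f0 g0] := ord_base.
have frec n := proj1 (ord_recurrence n); have grec n := proj2 (ord_recurrence n).
have near1 : locally 0 (fun x => Rabs x < 1).
  by apply: (locally_bounded id 1 (continuous_id 0)); rewrite Rabs_R0; lra.
have c0 : c_ 0 = 1 by rewrite /c_ Rdiv_0_l cos_0.
have s0 : s_ 0 = 0 by rewrite /s_ Rdiv_0_l sin_0.
have ch0 : ch_ 0 = 1 by rewrite /ch_ Rmult_0_r Rdiv_0_l cosh_0.
have sh0 : sh_ 0 = 0 by rewrite /sh_ Rmult_0_r Rdiv_0_l sinh_0.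
have near : locally 0 (fun x => PSeries (even_part (egf ord_nvalid)) x = A_ x /\
    PSeries (odd_part (egf ord_nvalid)) x = B_ x).
  (* Both solutions start from the values 1, 0, 0, 1 of A, B, H, U. *)
  apply: (solves_unique _ _ (PSeries (odd_part (egf ord_ntrue_ended)))
     (PSeries (even_part (egf ord_ntrue_ended))) _ _ H_ U_);
    rewrite ?PSeries_0 /even_part /odd_part /egf /= ?f0 ?g0 /A_ /B_ /H_ /U_ /den ?c0 ?s0 ?ch0 ?sh0 /=;
    try (by field).
    apply: filter_imp near1 => x.
    exact: (generating_solves ord_nvalid_le ord_ntrue_ended_le frec grec).
  apply: filter_imp den_neq0_near; exact: closed_form_solves.
have [r Hr] := filter_and _ _ near (filter_and _ _ den_neq0_near near1).
exists r; split; first exact: cond_pos.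
move=> x xr; have [|[Ax Bx] [dx x1]] := Hr x.
  by change (Rabs (x - 0) < r); rewrite Rminus_0_r.
rewrite -A_plus_B // -Ax -Bx.
apply/is_series_Reals; move/is_series_Reals: (infinite_sum_egf ord_nvalid_le x1).
by apply: is_series_ext => n; rewrite f_countE.
Qed.
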